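(* Let $\mathbb F$ be a subfield of $\mathbb C$, let $X$ be a nonempty set, and let $A\subseteq\mathbb F^X$ be a function algebra over $\mathbb F$. Assume that $A$ contains all the bounded functions in $\mathbb F^X$, and that $A$ contains a discrete function $f$. Then every element of $A$ is a sum of two units of $A$, and the only linear functionals $\Lambda:A\to\mathbb F$ such that $\Lambda(u)\neq0$ for all $u\in\mathcal U(A)$ and $\Lambda(\mathbf 1)=1$ are projections $p_x$ with $x\in X$. Thus $A$ is a GKŻ algebra.
   Context: A function algebra over $\mathbb F$ on a nonempty set $X$ is a subalgebra $A$ of the $\mathbb F$-algebra $\mathbb F^X$ of all functions $X\to\mathbb F$ (pointwise operations) containing the constant function $\mathbf 1$. $\mathcal U(A)$ is the group of units of $A$. For $x\in X$, the projection is $p_x:A\to\mathbb F$, $p_x(f)=f(x)$. A function $f\in\mathbb F^X$ is discrete if $f(X)$ is a closed discrete subset of $\mathbb C$ (i.e. $f(X)$ has no accumulation point in $\mathbb C$) and $f^{-1}(\lambda)$ is finite for every $\lambda\in\mathbb C$; equivalently, $\{x\in X: |f(x)|\le r\}$ is finite for every $r>0$. A unital algebra $A$ over $\mathbb F$ is a GKŻ algebra if every linear functional $\Lambda:A\to\mathbb F$ such that $\Lambda(u)\neq0$ for all $u\in\mathcal U(A)$ and $\Lambda(\mathbf 1_A)=1$ is multiplicative. *)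

(* Defs.v *)
From HB Require Import structures.
From mathcomp Require Import all_boot all_order all_algebra.
From mathcomp Require Import all_classical all_reals all_analysis.
From mathcomp Require Import complex.

Set Implicit Arguments.
Unset Strict Implicit.
Unset Printing Implicit Defensive.

Import Order.TTheory GRing.Theory Num.Theory.
Import numFieldNormedType.Exports.

Local Open Scope classical_set_scope.
Local Open Scope ring_scope.

(* A [divringClosed] predicate on a field is exactly a subfield of it. *)
Section Subfield.
Variables (L : fieldType) (F : divringClosed L).

Definition subfield := {x : L | x \in F}.

HB.instance Definition _ := SubChoice.on subfield.
HB.instance Definition _ := [SubChoice_isSubIntegralDomain of subfield by <:].
HB.instance Definition _ := [SubIntegralDomain_isSubField of subfield by <:].

End Subfield.

(* The regular module [K^o] carries the scaling of [K] on itself, so that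
   [X -> K^o] is the algebra [K^X] with its pointwise operations. *)
Section FunctionAlgebra.
Variables (X : pointedType) (K : fieldType).

Let fct_scalerAl (a : K) (f g : X -> K^o) : a *: (f * g) = a *: f * g.
Proof. by apply/funext => x; exact: mulrA. Qed.

HB.instance Definition _ :=
  GRing.LSemiModule_isLSemiAlgebra.Build K (X -> K^o) fct_scalerAl.

Let fct_scalerAr (a : K) (f g : X -> K^o) : a *: (f * g) = f * (a *: g).
Proof. by apply/funext => x; exact: mulrCA. Qed.

HB.instance Definition _ :=
  GRing.LSemiAlgebra_isSemiAlgebra.Build K (X -> K^o) fct_scalerAr.

Variable A : subalgClosed (X -> K^o).

Definition funalg := {f : X -> K^o | f \in A}.

HB.instance Definition _ := SubChoice.on funalg.
HB.instance Definition _ := [SubChoice_isSubAlgebra of funalg by <:].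

Definition projection (x : X) (f : funalg) : K := \val f x.

End FunctionAlgebra.

Definition is_unit (A : pzRingType) (u : A) : Prop :=
  exists v : A, v * u = 1 /\ u * v = 1.

Section GKZ.
Variables (K : fieldType) (A : algType K).

Definition GKZ_functional (Lambda : {scalar A}) : Prop :=
  (forall u : A, is_unit u -> Lambda u != 0) /\ Lambda 1 = 1.

Definition GKZ_algebra : Prop :=
  forall Lambda : {scalar A}, GKZ_functional Lambda ->
    {morph Lambda : f g / f * g}.

End GKZ.

Definition discrete_function (R : realType) (X : Type) (f : X -> R[i]) : Prop :=
  [/\ closed (range f : set R[i]^o),
      range f `<=` isolated (range f : set R[i]^o) &
      forall z : R[i], finite_set (f @^-1` [set z])].

(* Being closed and discrete amounts to having no accumulation point. *)
Lemma closed_discreteP (T : topologicalType) (S : set T) :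
  (closed S /\ S `<=` isolated S) <-> limit_point S = set0.
Proof.
have dis := disjoint_isolated_limit_point S.
split=> [[cS iS]|lS].
  apply/seteqP; split=> [t lt|//].
  have St : S t by apply: cS; exact: subset_limit_point.
  by move/disj_setPS: dis => /(_ t); apply; split => //; exact: iS.
have e := closure_isolated_limit_point S; rewrite lS setU0 in e.
split; first by rewrite /closed e; exact: isolatedS.
by rewrite -e; exact: subset_closure.
Qed.

(* Main.v *)
(* A function whose modulus is bounded below has a bounded inverse, so it is a
   unit of A; adding a suitable bounded function of modulus in [1, 4] to any
   a in A makes both terms of a = (a + b) + (- b) of this kind.
   Let Lambda be nonzero on units with Lambda 1 = 1, and let c = Lambda f and
   Z = f^-1(c), a finite set.  As f is discrete, f - c + 1_Z is a unit, so
   Lambda 1_Z <> 0, whence Lambda 1_{x} <> 0 for some x in Z, and then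
   Lambda 1_{x} = 1 since otherwise 1_{x} - Lambda 1_{x} would be a unit in the
   kernel.  If u vanishes at x and has modulus >= 1 elsewhere, then
   u - (Lambda u) 1_{x} lies in the kernel, so it is not a unit and
   Lambda u = 0.  Every function vanishing at x is a sum of two such u. *)

Require Import Defs.
From HB Require Import structures.
From mathcomp Require Import all_boot all_order all_algebra.
From mathcomp Require Import all_classical all_reals all_analysis.
From mathcomp Require Import complex.

Set Implicit Arguments.
Unset Strict Implicit.
Unset Printing Implicit Defensive.

Import Order.TTheory GRing.Theory Num.Theory.
Import numFieldNormedType.Exports.

Local Open Scope classical_set_scope.
Local Open Scope ring_scope.

(** The range has no accumulation point, so some ball about [z] meets it at most in [z]; [e] is the
    radius of that ball. *)
Lemma discrete_function_away (R : realType) (X : Type) (f : X -> R[i]) (z : R[i]) :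
  discrete_function f ->
  exists2 e : R[i], 0 < e & forall x, f x != z -> e <= `|f x - z|.
Proof.
case=> cf df _; have lim0 := (closed_discreteP (range f : set R[i]^o)).1 (conj cf df).
have /existsNP[U /not_implyP[/nbhs_ballP[e /= e0 eU] nU]] :
    ~ limit_point (range f : set R[i]^o) z by rewrite lim0.
exists e => // x fxz; rewrite real_leNgt ?normr_real ?gtr0_real //.
apply/negP => fxe; apply: nU; exists (f x); split; [by []|by exists x|].
by apply: eU; rewrite -ball_normE /= distrC.
Qed.

Section Pointwise.
Variables (X : pointedType) (K : fieldType) (A : subalgClosed (X -> K^o)).
Implicit Types a b : funalg A.

Definition to_funalg (g : X -> K^o) (gA : g \in A) : funalg A :=
  @exist _ (fun h => h \in A) g gA.

Lemma funalg_eqP a b : (forall x, \val a x = \val b x) -> a = b.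
Proof. by move=> ab; apply/val_inj/funext. Qed.

Lemma funalg0 x : \val (0 : funalg A) x = 0.
Proof. exact: (congr1 (@^~ x) (rmorph0 (\val : funalg A -> (X -> K^o)))). Qed.

Lemma funalg1 x : \val (1 : funalg A) x = 1.
Proof. exact: (congr1 (@^~ x) (rmorph1 (\val : funalg A -> (X -> K^o)))). Qed.

Lemma funalgD a b x : \val (a + b) x = \val a x + \val b x.
Proof. exact: (congr1 (@^~ x) (rmorphD (\val : funalg A -> (X -> K^o)) a b)). Qed.

Lemma funalgN a x : \val (- a) x = - \val a x.
Proof. exact: (congr1 (@^~ x) (rmorphN (\val : funalg A -> (X -> K^o)) a)). Qed.

Lemma funalgM a b x : \val (a * b) x = \val a x * \val b x.
Proof. exact: (congr1 (@^~ x) (rmorphM (\val : funalg A -> (X -> K^o)) a b)). Qed.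

Lemma funalgZ c a x : \val (c *: a) x = c * \val a x.
Proof. exact: (congr1 (@^~ x) (linearZ_LR (\val : funalg A -> (X -> K^o)) c a)). Qed.

End Pointwise.

(** * Units and bounded functions *)

Section FunctionAlgebra.
Variables (R : realType) (F : divringClosed R[i]) (X : pointedType).
Local Notation K := (subfield F).

Lemma shift_off_disk (a : X -> K^o) : exists b : X -> K^o,
  forall x, [/\ 1 <= `|\val (b x)| :> R[i], `|\val (b x)| <= 4 :> R[i] &
                1 <= `|\val (a x + b x)| :> R[i]].
Proof.
(* Adding 1 where [|a| >= 2] leaves modulus at least 1; adding 4 where [|a| < 2] leaves more than 2.
   Both constants lie in every subfield. *)
exists (fun x => if 2 <= `|\val (a x)| :> R[i] then 1 else 4) => x.
have n4 : \val (4 : K^o) = 4 :> R[i] by rewrite rmorph_nat.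
have [ax|ax] := real_leP (realn R[i] 2) (normr_real (\val (a x))).
- rewrite -[\val (a x + 1)]/(\val (a x) + 1) -[\val 1]/1 normr1 ler1n; split => //.
  by apply: le_trans (lerB_normD _ _); rewrite normr1 lerBrDr.
- rewrite -[\val (a x + 4)]/(\val (a x) + \val (4 : K^o)) n4.
  rewrite [\val (a x) + _]addrC normr_nat lexx ler1n; split => //.
  apply: le_trans (lerB_normD _ _).
  rewrite normr_nat lerBrDr -lerBrDl; apply: le_trans (ltW ax) _.
  by rewrite lerBrDr natr1 ler_nat.
Qed.

Variable A : subalgClosed (X -> K^o).
Hypothesis bounded_in_A : forall g : X -> K^o,
  bounded_fun (fun x => \val (g x) : R[i]^o) -> g \in A.

Lemma norm_bounded_in (g : X -> K^o) (M : R[i]) :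
  (forall x, `|\val (g x)| <= M) -> g \in A.
Proof.
move=> gM; apply: bounded_in_A; exists M.
(* [bounded_fun] asks for a real threshold; [M] is real because it dominates a norm at the base
   point of [X]. *)
split; first by apply: ger0_real; exact: le_trans (gM point).
by move=> y /ltW My x _; exact: le_trans (gM x) My.
Qed.

Lemma indic_in (S : set X) : (\1_S : X -> K^o) \in A.
Proof.
apply: (@norm_bounded_in _ 1) => x.
rewrite indicE; case: (x \in S); last by rewrite rmorph0 normr0.
by rewrite rmorph1 normr1.
Qed.

(** The pointwise inverse has values in the subfield and is bounded, hence lies in [A]. Nonvanishing
    is assumed separately, since [0^-1 = 0] satisfies the bound. *)
Lemma bounded_inverse_is_unit (a : funalg A) (M : R[i]) :
  (forall x, \val a x != 0) -> (forall x, `|\val (\val a x)|^-1 <= M) ->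
  is_unit a.
Proof.
move=> a0 aM.
have vA : (fun x => (\val a x)^-1 : K^o) \in A.
  by apply: (@norm_bounded_in _ M) => x; rewrite fmorphV normfV; exact: aM.
exists (to_funalg vA); split; apply: funalg_eqP => x; rewrite funalgM funalg1.
- exact: (@mulVf K).
- exact: (@mulfV K).
Qed.

Lemma bounded_below_is_unit (a : funalg A) (e : R[i]) : 0 < e ->
  (forall x, e <= `|\val (\val a x)|) -> is_unit a.
Proof.
move=> e0 ae; have n0 x : 0 < `|\val (\val a x)| by exact: lt_le_trans (ae x).
apply: (@bounded_inverse_is_unit _ e^-1) => x.
  by have := n0 x; rewrite normr_gt0 fmorph_eq0.
by rewrite lef_pV2 ?posrE.
Qed.

Lemma sum_two_units (a : funalg A) :
  exists u v : funalg A, [/\ is_unit u, is_unit v & a = u + v].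
Proof.
have [b bP] := shift_off_disk (\val a).
have bA : b \in A by apply: (@norm_bounded_in _ 4) => x; case: (bP x).
pose B := to_funalg bA.
exists (a + B), (- B); split; last by rewrite addrK.
- by apply: (@bounded_below_is_unit _ 1) => // x; case: (bP x).
- apply: (@bounded_below_is_unit _ 1) => // x.
  by rewrite -[\val (\val (- B) x)]/(- \val (b x)) normrN; case: (bP x).
Qed.

Definition ind (S : set X) : funalg A := to_funalg (indic_in S).

Lemma indE (S : set X) x : \val (ind S) x = (x \in S)%:R.
Proof. exact: indicE. Qed.

(** * Functionals that do not vanish on units *)

Section Functional.
Variable Lambda : {scalar (funalg A)}.
Hypothesis Lambda_GKZ : GKZ_functional Lambda.

Lemma functional_unit_neq0 u : is_unit u -> Lambda u != 0.
Proof. exact: Lambda_GKZ.1. Qed.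

Lemma functional1 : Lambda 1 = 1.
Proof. exact: Lambda_GKZ.2. Qed.

Lemma functional_const (c : K) : Lambda (c *: 1) = c.
Proof. by rewrite linearZ /= functional1 mulr1. Qed.

(** By additivity: the indicator of a finite set is the sum of the indicators of its points. *)
Lemma functional_ind_finite (s : seq X) : Lambda (ind [set` s]) != 0 ->
  exists x, Lambda (ind [set x]) != 0.
Proof.
elim: s => [|x s IHs] Ls.
  suff i0 : ind [set` [::]] = 0 by rewrite i0 linear0 eqxx in Ls.
  by apply: funalg_eqP => y; rewrite indE funalg0 mem_setE.
have [Lx|Lx] := eqVneq (Lambda (ind [set x])) 0; last by exists x.
(* A repeated head leaves the set unchanged; only a new one contributes a summand. *)
apply: IHs; have [xs|xs] := boolP (x \in s).
  suff <- : [set` x :: s] = [set` s] by [].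
  apply/seteqP; split=> y /=; rewrite inE; first by case/orP=> // /eqP ->.
  by move=> ->; rewrite orbT.
suff e : ind [set` x :: s] = ind [set x] + ind [set` s].
  by move: Ls; rewrite e linearD /= Lx add0r.
apply: funalg_eqP => y; rewrite funalgD !indE !mem_setE in_cons in_set1.
have [->|_] := eqVneq y x; first by rewrite (negbTE xs) addr0.
by rewrite add0r.
Qed.

Lemma functional_ind_level (f : funalg A) (c := Lambda f) :
  discrete_function (fun x => \val (\val f x) : R[i]) ->
  Lambda (ind [set x | \val f x = c]) != 0.
Proof.
move=> df; have [e e0 fe] := discrete_function_away (\val c) df.
set Z := [set x | _].
(* [f - c] lies in the kernel. The new argument is 1 on [Z] and [f - c] off [Z], where its modulus
   is at least [e]. *)
have -> : Lambda (ind Z) = Lambda (f - c *: 1 + ind Z).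
  by rewrite linearD linearB /= functional_const subrr add0r.
set g := f - _ + _.
have gE x : \val g x = if \val f x == c then 1 else \val f x - c.
  rewrite !funalgD funalgN funalgZ funalg1 indE mulr1.
  have [fx|fx] := eqVneq; first by rewrite mem_set // fx subrr add0r.
  by rewrite memNset ?addr0 //; exact/eqP.
apply: functional_unit_neq0; apply: (@bounded_inverse_is_unit _ (1 + e^-1)) => x.
all: rewrite gE; case: (eqVneq (\val f x) c) => [_|fx].
- exact: oner_neq0.
- by rewrite subr_eq0.
- by rewrite rmorph1 normr1 invr1 lerDl invr_ge0 ltW.
- have efx : e <= `|\val (\val f x - c)| by rewrite rmorphB; exact: fe.
  rewrite -[leLHS]add0r lerD // lef_pV2 // posrE.
  exact: lt_le_trans efx.
Qed.

Lemma functional_ind_point (x : X) :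
  Lambda (ind [set x]) != 0 -> Lambda (ind [set x]) = 1.
Proof.
set c := Lambda _ => c0; apply/eqP; rewrite eq_sym; apply: contraT => c1.
have /functional_unit_neq0 : is_unit (ind [set x] - c *: 1).
  (* The only possible values are [1 - c] and [- c], both nonzero; the sum of their inverse moduli
     bounds either one. *)
  apply: (@bounded_inverse_is_unit _ (`|\val (1 - c)|^-1 + `|\val c|^-1)) => y;
    rewrite funalgD funalgN funalgZ funalg1 indE mulr1; case: (y \in _).
  - by rewrite subr_eq0.
  - by rewrite sub0r oppr_eq0.
  - by rewrite lerDl invr_ge0.
  - by rewrite sub0r rmorphN normrN lerDr invr_ge0.
by rewrite linearB /= functional_const subrr eqxx.
Qed.

Lemma functional_vanish (x : X) (u : funalg A) : Lambda (ind [set x]) = 1 ->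
  \val u x = 0 -> (forall y, y != x -> 1 <= `|\val (\val u y)| :> R[i]) ->
  Lambda u = 0.
Proof.
set c := Lambda u => Lx ux u1; apply/eqP; apply: contraT => c0.
have /functional_unit_neq0 : is_unit (u - c *: ind [set x]).
  (* The correction changes [u] only at [x], replacing its zero there by [- c]. *)
  have vE y : \val (u - c *: ind [set x]) y = if y == x then - c else \val u y.
    rewrite funalgD funalgN funalgZ indE in_set1.
    by case: eqVneq => [->|_]; rewrite ?ux ?mulr1 ?mulr0 ?sub0r ?subr0.
  apply: (@bounded_inverse_is_unit _ (`|\val c|^-1 + 1)) => y; rewrite vE;
    case: (eqVneq y x) => [_|/u1 uy].
  - by rewrite oppr_eq0.
  - by apply: contraTneq uy => ->; rewrite rmorph0 normr0 ler10.
  - by rewrite rmorphN normrN lerDl.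
  - rewrite -[leLHS]add0r lerD ?invr_ge0 // invf_le1 //.
    exact: lt_le_trans uy.
by rewrite linearB linearZ /= Lx mulr1 subrr eqxx.
Qed.

Lemma functional_eq0 (x : X) (a : funalg A) : Lambda (ind [set x]) = 1 ->
  \val a x = 0 -> Lambda a = 0.
Proof.
move=> Lx ax; have [b bP] := shift_off_disk (\val a).
(* Resetting the shift to 0 at [x] makes both terms of [a = (a + b') - b'] vanish at [x], with
   modulus at least 1 elsewhere. *)
have b'A : (fun y => if y == x then 0 else b y : K^o) \in A.
  apply: (@norm_bounded_in _ 4) => y; case: eqP => _; last by case: (bP y).
  by rewrite rmorph0 normr0.
pose b' := to_funalg b'A.
have b'E y : \val b' y = if y == x then 0 else b y by [].
rewrite -(addrK b' a) linearB /= !(functional_vanish Lx) ?subrr //.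
- by rewrite b'E eqxx.
- by move=> y /negbTE yx; rewrite b'E yx; case: (bP y).
- by rewrite funalgD b'E ax eqxx addr0.
- by move=> y /negbTE yx; rewrite funalgD b'E yx; case: (bP y).
Qed.

(** The difference of [a] and the constant [\val a x] vanishes at [x], so [Lambda] kills it. *)
Lemma functional_projection (x : X) : Lambda (ind [set x]) = 1 ->
  Lambda =1 @projection X _ A x.
Proof.
move=> Lx a; rewrite /projection; set c : K := \val a x.
apply: subr0_eq; rewrite -[X in _ - X]functional_const -linearB.
apply: (functional_eq0 Lx).
by rewrite funalgD funalgN funalgZ funalg1 mulr1 subrr.
Qed.

End Functional.

Lemma projection_GKZ (x : X) (Lambda : {scalar (funalg A)}) :
  Lambda =1 @projection X _ A x -> GKZ_functional Lambda.
Proof.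
move=> Lx; split; last by rewrite Lx /projection funalg1.
(* Evaluating [v * u = 1] at [x] rules out a zero of [u] there. *)
move=> u [v [vu _]]; rewrite Lx /projection; apply: contra_eq_neq vu => ux.
apply/eqP => /(congr1 (fun w : funalg A => \val w x)).
by rewrite funalgM funalg1 ux mulr0 => /esym/eqP; rewrite oner_eq0.
Qed.

End FunctionAlgebra.

Theorem corollary3p12 (R : realType) (F : divringClosed R[i])
    (X : pointedType) (A : subalgClosed (X -> (subfield F)^o))
    (bounded_in_A : forall g : X -> (subfield F)^o,
      bounded_fun (fun x => \val (g x) : R[i]^o) -> g \in A)
    (f : X -> (subfield F)^o) (f_in_A : f \in A)
    (f_discrete : discrete_function (fun x => \val (f x) : R[i])) :
  [/\ forall a : funalg A,
        exists u v : funalg A, [/\ is_unit u, is_unit v & a = u + v],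
      forall Lambda : {scalar (funalg A)},
        GKZ_functional Lambda <-> exists x : X, Lambda =1 @projection X _ A x &
      GKZ_algebra (funalg A)].
Proof.
have only_projections (Lambda : {scalar (funalg A)}) :
    GKZ_functional Lambda -> exists x : X, Lambda =1 @projection X _ A x.
  move=> GKZ; pose c := Lambda (to_funalg f_in_A).
  have := functional_ind_level bounded_in_A GKZ (f := to_funalg f_in_A)
    f_discrete.
  have /finite_seqP[s ->] : finite_set [set x | f x = c].
    by case: f_discrete => _ _ /(_ (\val c)); apply: sub_finite_set => x /= ->.
  case/functional_ind_finite => x /(functional_ind_point GKZ).
  by move=> Lx; exists x; exact: functional_projection Lx.
split; first exact: sum_two_units.
- by move=> Lambda; split=> [/only_projections//|[x]]; exact: projection_GKZ.
- by move=> Lambda /only_projections[x Lx] a b; rewrite !Lx /projection funalgM.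
Qed.
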